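(* Let $(\omega_n)_{n\ge0}$ be a sequence of nonzero (complex) scalars, and put $\mu_{i,j}=\omega_{i+j}$ for $i,j\ge0$. Consider $$X=\ell^2(V_\infty,\mu),\qquad \|f\|_X^2=\sum_{i,j\ge0}|\omega_{i+j}f(v_{i,j})|^2.$$ Suppose that the backward shift $B$ of the lattice graph $G_\infty$ is bounded on $X$. Let $\mathcal F$ be a Furstenberg family on $\mathbb N_0$, and let $\widetilde{\mathcal F}$ be its associated enlarged family. Then the following assertions are equivalent: (i) $B$ is $\widetilde{\mathcal F}$-transitive; (ii) $B$ is $\mathcal F$-transitive; (iii) for every $q\in\mathbb N_0$ and $\varepsilon>0$, $$\left\{n\in\mathbb N:\frac{|\omega_{q+n}|}{|\omega_q|}\,\frac{(n+1)^{q/2+1/4}}{2^n}<\varepsilon\right\}\in\mathcal F.$$ If, in addition, $A\in\mathcal F$ implies $A\cap[N,\infty)\in\mathcal F$ for every $N\in\mathbb N$, then the preceding assertions are also equivalent to (iv) $B$ is topologically $\mathcal F$-recurrent.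
   Context: $\mathbb N=\{1,2,\dots\}$, $\mathbb N_0=\{0,1,2,\dots\}$. $G_\infty$ is the directed graph with vertex set $V_\infty=\{v_{i,j}:i,j\in\mathbb N_0\}$ and edges $v_{i,j}\to v_{i+1,j}$ and $v_{i,j}\to v_{i,j+1}$ for all $i,j\in\mathbb N_0$. $\ell^2(V_\infty,\mu)$ is the Hilbert space of functions $f:V_\infty\to\mathbb C$ with $\|f\|_X<\infty$. The backward shift sums over children: $(Bf)(v_{i,j})=f(v_{i+1,j})+f(v_{i,j+1})$. Furstenberg families: a nonempty collection $\mathcal F$ of subsets of $\mathbb N_0$ is a Furstenberg family if every member of $\mathcal F$ is infinite and $A\in\mathcal F$, $A\subseteq C\subseteq\mathbb N_0$ imply $C\in\mathcal F$. The enlarged family $\widetilde{\mathcal F}$ consists of all $A\subseteq\mathbb N_0$ such that for every $N\in\mathbb N_0$ there is $D\in\mathcal F$ with $(D+\{-N,-N+1,\dots,N\})\cap\mathbb N_0\subseteq A$; it is again a Furstenberg family. For a bounded linear operator $T$ on $X$ and nonempty open $U,V\subseteq X$, $N_T(U,V)=\{n\in\mathbb N_0:T^n(U)\cap V\ne\varnothing\}$. $T$ is $\mathcal F$-transitive if $N_T(U,V)\in\mathcal F$ for all nonempty open $U,V\subseteq X$ (and similarly for $\widetilde{\mathcal F}$); $T$ is topologically $\mathcal F$-recurrent if $N_T(U,U)\in\mathcal F$ for every nonempty open $U\subseteq X$. *)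

(* Defs.v *)
From HB Require Import structures.
From mathcomp Require Import all_boot all_order all_algebra.
From mathcomp Require Import complex ring.
From mathcomp Require Import all_classical all_reals all_analysis.
Import Order.TTheory GRing.Theory Num.Theory.
Import numFieldNormedType.Exports.
Import ComplexField.Normc.
Set Implicit Arguments.
Unset Strict Implicit.
Unset Printing Implicit Defensive.
Local Open Scope classical_set_scope.
Local Open Scope complex_scope.
Local Open Scope ring_scope.

Section WeightedEll2.
Context {R : realType} {V : choiceType}.
Implicit Types (mu f g : V -> R[i]).

(* [normc z : R] is the modulus of [z : R[i]]. *)
Definition ell2_sqnorm mu f : \bar R :=
  \esum_(v in [set: V]) (normc (mu v * f v) ^+ 2)%:E.

Definition ell2_pred mu : {pred V -> R[i]} :=
  mem [set f | (ell2_sqnorm mu f < +oo)%E].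

Lemma normc_ge0 (z : R[i]) : 0 <= normc z.
Proof. by case: z => a b; rewrite /= sqrtr_ge0. Qed.

Lemma ell2_sqnorm_ge0 mu f : (0 <= ell2_sqnorm mu f)%E.
Proof. by apply: esum_ge0 => v _; rewrite lee_fin sqr_ge0. Qed.

Lemma esum_scale_le (c : R) (a : V -> R) : 0 <= c -> (forall v, 0 <= a v) ->
  (\esum_(v in [set: V]) (c * a v)%:E <=
   c%:E * \esum_(v in [set: V]) (a v)%:E)%E.
Proof.
move=> c0 a0; apply: ge_ereal_sup => _ [A [finA AT] <-].
under eq_fsbigr do rewrite EFinM.
rewrite -ge0_mule_fsumr; last by move=> v; rewrite lee_fin.
apply: lee_wpmul2l; first by rewrite lee_fin.
by apply: ereal_sup_ubound; exists A.
Qed.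

Lemma ell2_sqnormZ_le mu (c : R[i]) f :
  (ell2_sqnorm mu (c *: f)%R <= (normc c ^+ 2)%:E * ell2_sqnorm mu f)%E.
Proof.
apply: le_trans (esum_scale_le (sqr_ge0 _) (fun v => sqr_ge0 _)).
apply: le_esum => v _.
by rewrite [(c *: f) v]/(c * f v) mulrCA normcM exprMn.
Qed.

Lemma ell2_sqnormD_le mu (t : R) f g : 0 < t ->
  (ell2_sqnorm mu (f + g)%R <=
   (1 + t)%:E * ell2_sqnorm mu f + (1 + t^-1)%:E * ell2_sqnorm mu g)%E.
Proof.
move=> t0; have ti0 : 0 < t^-1 by rewrite invr_gt0.
apply: (@le_trans _ _
  (\esum_(v in [set: V]) ((1 + t) * normc (mu v * f v) ^+ 2)%:E +
   \esum_(v in [set: V]) ((1 + t^-1) * normc (mu v * g v) ^+ 2)%:E)%E); last first.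
  by apply: leeD; apply: esum_scale_le => [|v]; rewrite ?sqr_ge0// addr_ge0// ltW.
rewrite -esumD; last 2 first.
- by move=> v _; rewrite lee_fin mulr_ge0 ?sqr_ge0// addr_ge0// ltW.
- by move=> v _; rewrite lee_fin mulr_ge0 ?sqr_ge0// addr_ge0// ltW.
apply: le_esum => v _; rewrite -EFinD lee_fin.
rewrite [(f + g) v]/(f v + g v) mulrDr.
set a := mu v * f v; set b := mu v * g v.
have le1 : normc (a + b) ^+ 2 <= (normc a + normc b) ^+ 2.
  rewrite ler_sqr ?nnegrE ?addr_ge0 ?normc_ge0//.
  by rewrite -lecR rmorphD; exact: (@ler_normD _ R[i]).
apply: (le_trans le1); move: (normc a) (normc b) => x y.
rewrite -subr_ge0.
have -> : (1 + t) * x ^+ 2 + (1 + t^-1) * y ^+ 2 - (x + y) ^+ 2 =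
          t^-1 * (t * x - y) ^+ 2 by field; rewrite gt_eqF.
by rewrite mulr_ge0 ?sqr_ge0// ltW.
Qed.

Lemma ell2_submod_closed mu : submod_closed (ell2_pred mu).
Proof.
split.
  apply: mem_set; rewrite /= /ell2_sqnorm esum1 ?ltry// => v _.
  by rewrite mulr0 normc0 expr0n.
move=> c f g /set_mem /= ff /set_mem /= gf; apply: mem_set => /=.
apply: le_lt_trans (ell2_sqnormD_le _ _ _ ltr01) _.
have cf : (ell2_sqnorm mu (c *: f)%R < +oo)%E.
  apply: le_lt_trans (ell2_sqnormZ_le _ _ _) _.
  by rewrite lte_mul_pinfty// lee_fin sqr_ge0.
by rewrite lte_add_pinfty// lte_mul_pinfty// lee_fin addr_ge0// ?invr_ge0.
Qed.

HB.instance Definition _ mu := GRing.isSubmodClosed.Build _ _ (ell2_pred mu)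
  (ell2_submod_closed mu).

(* The space $\ell^2(V, \mu)$; the weights are nonzero, so that the weighted
   norm is definite. *)
Record ell2 mu (mu0 : forall v, mu v != 0) := Ell2 {
  ell2_fun :> V -> R[i];
  ell2_funP : ell2_fun \in ell2_pred mu }.

Section Normed.
Context mu (mu0 : forall v, mu v != 0).

HB.instance Definition _ := [isSub for @ell2_fun mu mu0].
HB.instance Definition _ := [Choice of ell2 mu0 by <:].
HB.instance Definition _ := [SubChoice_isSubLmodule of ell2 mu0 by <:].

Implicit Types x y : ell2 mu0.

Definition ell2_rnorm x : R := Num.sqrt (fine (ell2_sqnorm mu x)).

Definition ell2_norm x : R[i] := (ell2_rnorm x)%:C.

Lemma ell2_sqnormE x : ell2_sqnorm mu x = (ell2_rnorm x ^+ 2)%:E.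
Proof.
have := ell2_sqnorm_ge0 mu x.
have /set_mem /= := ell2_funP x; rewrite /ell2_rnorm.
by case: ell2_sqnorm => //= r _; rewrite lee_fin => r0; rewrite sqr_sqrtr.
Qed.

Lemma ell2_rnorm_ge0 x : 0 <= ell2_rnorm x.
Proof. exact: sqrtr_ge0. Qed.

Lemma ell2_norm_eq0 x : ell2_norm x = 0 -> x = 0.
Proof.
move=> /complexI x0; apply: val_inj; apply/funext => v /=.
have : ((normc (mu v * x v) ^+ 2)%:E <= ell2_sqnorm mu x)%E.
  apply: ereal_sup_ubound; exists [set v]; last by rewrite fsbig_set1.
  by split; [exact: finite_set1|].
rewrite ell2_sqnormE x0 expr0n lee_fin => le0.
have /eqP : normc (mu v * x v) ^+ 2 == 0 by rewrite eq_le le0 sqr_ge0.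
move=> /eqP; rewrite sqrf_eq0 => /eqP /eq0_normc /eqP.
by rewrite mulf_eq0 (negbTE (mu0 v)) => /eqP.
Qed.

Lemma ell2_rnormZ_le (c : R[i]) x :
  ell2_rnorm (c *: x) <= normc c * ell2_rnorm x.
Proof.
rewrite -ler_sqr ?nnegrE ?mulr_ge0 ?normc_ge0 ?ell2_rnorm_ge0//.
rewrite -lee_fin -ell2_sqnormE exprMn.
by rewrite [leRHS]EFinM -ell2_sqnormE ell2_sqnormZ_le.
Qed.

Lemma ell2_normZ (c : R[i]) x : ell2_norm (c *: x) = `|c| * ell2_norm x.
Proof.
rewrite -[`|c|]/((normc c)%:C) /ell2_norm -rmorphM; congr _%:C.
apply/eqP; rewrite eq_le ell2_rnormZ_le /=.
have [->|c0] := eqVneq c 0; first by rewrite normc0 mul0r ell2_rnorm_ge0.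
have nc0 : 0 < normc c.
  rewrite lt_neqAle normc_ge0 andbT eq_sym.
  by apply: contra_neq c0 => /eq0_normc.
rewrite -ler_pdivlMl// -normcV.
by rewrite -{1}[x](scalerK c0) ell2_rnormZ_le.
Qed.

Lemma ell2_normD x y : ell2_norm (x + y) <= ell2_norm x + ell2_norm y.
Proof.
have [x0|x0] := eqVneq (ell2_rnorm x) 0.
  rewrite (@ell2_norm_eq0 x) ?add0r /ell2_norm ?x0//.
  by rewrite lerDr lecR ell2_rnorm_ge0.
have [y0|y0] := eqVneq (ell2_rnorm y) 0.
  rewrite (@ell2_norm_eq0 y) ?addr0 /ell2_norm ?y0//.
  by rewrite lerDl lecR ell2_rnorm_ge0.
have xp : 0 < ell2_rnorm x by rewrite lt_neqAle eq_sym x0 ell2_rnorm_ge0.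
have yp : 0 < ell2_rnorm y by rewrite lt_neqAle eq_sym y0 ell2_rnorm_ge0.
rewrite /ell2_norm -rmorphD lecR.
rewrite -ler_sqr ?nnegrE ?addr_ge0 ?ell2_rnorm_ge0// -lee_fin -ell2_sqnormE.
apply: le_trans (ell2_sqnormD_le _ _ _ (divr_gt0 yp xp)) _.
rewrite !ell2_sqnormE -!EFinM -EFinD lee_fin le_eqVlt; apply/orP; left.
by apply/eqP; field; rewrite x0 y0.
Qed.

HB.instance Definition _ := Lmodule_isNormed.Build R[i] (ell2 mu0)
  ell2_normD ell2_normZ ell2_norm_eq0.

Lemma ell2_normE x : `|x| = (Num.sqrt (fine (ell2_sqnorm mu x)))%:C.
Proof. by []. Qed.

End Normed.
End WeightedEll2.

(* The vertex $v_{i,j}$ of $G_\infty$ is the pair [(i, j)]. *)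
Definition lattice_children (v : nat * nat) : seq (nat * nat) :=
  [:: (v.1.+1, v.2); (v.1, v.2.+1)].

Definition lattice_shift {R : realType} (f : nat * nat -> R[i]) :
    nat * nat -> R[i] :=
  fun v => \sum_(u <- lattice_children v) f u.

Definition level_weight {R : realType} (omega : nat -> R[i]) :
    nat * nat -> R[i] :=
  fun v => omega (v.1 + v.2)%N.

Lemma level_weight_neq0 {R : realType} (omega : nat -> R[i]) :
  (forall n, omega n != 0) -> forall v, level_weight omega v != 0.
Proof. by move=> omega0 v; exact: omega0. Qed.

Definition furstenberg_family (F : set (set nat)) : Prop :=
  [/\ F !=set0,
      forall A, F A -> infinite_set A
    & forall A C, F A -> A `<=` C -> F C].

Definition enlarged_family (F : set (set nat)) : set (set nat) :=
  [set A | forall N : nat, exists2 D, F D &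
    [set n : nat | exists d (k : int),
       [/\ D d, - N%:Z <= k <= N%:Z & n%:Z = d%:Z + k]] `<=` A].

Section Recurrence.
Context {X : topologicalType}.
Implicit Types (T : X -> X) (F : set (set nat)).

Definition return_set T (U V : set X) : set nat :=
  [set n | (iter n T @` U) `&` V !=set0].

Definition family_transitive F T : Prop :=
  forall U V : set X, open U -> U !=set0 -> open V -> V !=set0 ->
    F (return_set T U V).

Definition family_recurrent F T : Prop :=
  forall U : set X, open U -> U !=set0 -> F (return_set T U U).

End Recurrence.

(* Main.v *)
(* Level m of the lattice is a copy of C^(m+1), and B^n maps level q+n to level
   q; its adjoint is multiplication of polynomials of degree <= q by (1+x)^n.
   The squared coefficient norm S(j,b) of (1-x)^j (1+x)^b satisfies
   S(j+1,b) + S(j,b+1) = 4 S(j,b) by the parallelogram law, so it is a super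
   Catalan number, of order 4^b b^(-j-1/2). Testing B^n f against (1-x)^q, whose
   image (1-x)^q (1+x)^n is exceptionally small, shows that returns force the
   weights at level q+n to be small. Conversely, the operator N - 2x d/dx
   multiplies the coefficient of x^l by N-2l and sends (1-x)^k (1+x)^(N-k) to
   k (1-x)^(k-1) (1+x)^(N-k+1) + (N-k) (1-x)^(k+1) (1+x)^(N-k-1). With N = 2n+q,
   Lagrange interpolation in this operator applied to (1+x)^N isolates one of
   the q+1 central coefficients and stays divisible by (1+x)^n; the quotient is
   a preimage under B^n of a unit vector of level q with the optimal norm.
   Boundedness of B controls |omega_a| by |omega_b| for a <= b, so a single level
   Q governs all levels below it and all nearby times. *)
Require Import Defs.
From HB Require Import structures.
From mathcomp Require Import all_boot all_order all_algebra.
From mathcomp Require Import complex.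
From mathcomp Require Import ring lra zify.
From mathcomp Require Import all_classical all_reals all_analysis.
Import Order.TTheory GRing.Theory Num.Theory.
Import numFieldNormedType.Exports.
Import ComplexField.Normc.
Local Open Scope classical_set_scope.
Local Open Scope complex_scope.
Local Open Scope ring_scope.

(** * Coefficient norms of the polynomials (1-x)^j (1+x)^b *)

Definition sqcoef {R : rcfType} (K : nat) (p : {poly R}) : R :=
  \sum_(l < K) p`_l ^+ 2.

(** Generating polynomial of the binary Krawtchouk polynomials: its coefficient of x^l is K_l(j;
    j+b). *)
Definition krawt {R : rcfType} (j b : nat) : {poly R} :=
  (1 - 'X) ^+ j * (1 + 'X) ^+ b.

Lemma size_krawt {R : rcfType} j b : (size (krawt (R := R) j b) <= (j + b).+1)%N.
Proof.
have s1 : size (1 - 'X : {poly R}) = 2.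
  by rewrite -opprB size_polyN -polyC1 size_XsubC.
have s2 : size (1 + 'X : {poly R}) = 2 by rewrite addrC -polyC1 size_XaddC.
apply: leq_trans (size_polyMleq _ _) _.
have := size_poly_exp_leq (1 - 'X : {poly R}) j.
have := size_poly_exp_leq (1 + 'X : {poly R}) b.
rewrite s1 s2 /=; move: (size _) (size _) => u v; lia.
Qed.

(** Coefficientwise this is the parallelogram law for p_l and p_(l-1); [K.+1] coefficients leave
    room for all of x p, which has the same norm as p. *)
Lemma sqcoef_parallelogram {R : rcfType} K (p : {poly R}) : (size p <= K)%N ->
  sqcoef K.+1 ((1 - 'X) * p) + sqcoef K.+1 ((1 + 'X) * p) = 4 * sqcoef K p.
Proof.
move=> sp; rewrite /sqcoef -big_split /=.
transitivity (\sum_(l < K.+1) (2 * p`_l ^+ 2 + 2 * ('X * p)`_l ^+ 2)).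
  by apply: eq_bigr => l _; rewrite !mulrDl !mul1r mulNr !coefD coefN; ring.
rewrite big_split /= big_ord_recr /= [X in _ + X]big_ord_recl /=.
rewrite coefXM /= nth_default// [in RHS]mulr_sumr -!mulr_sumr.
rewrite expr0n /= !mulr0 addr0 add0r.
under [in X in _ + X]eq_bigr do rewrite coefXM /=.
ring.
Qed.

Lemma sqcoef_krawt_rec {R : rcfType} j b :
  sqcoef (j.+1 + b).+1 (krawt j.+1 b) + sqcoef (j + b.+1).+1 (krawt j b.+1) =
  4 * sqcoef (R := R) (j + b).+1 (krawt j b).
Proof.
by rewrite -sqcoef_parallelogram ?size_krawt// addSn addnS /krawt !exprS mulrA mulrCA.
Qed.

Lemma coef_1DX_exp {R : rcfType} b l : ((1 + 'X : {poly R}) ^+ b)`_l = 'C(b, l)%:R.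
Proof.
elim: b l => [|b IH] [|l]; rewrite ?expr0 ?coef1 ?bin0 ?bin0n// exprS mulrDl mul1r.
  by rewrite coefD coefXM /= addr0 IH bin0.
by rewrite coefD coefXM /= !IH binS natrD.
Qed.

Lemma sqcoef_krawt0 {R : rcfType} b :
  sqcoef (R := R) b.+1 (krawt 0 b) = 'C(b.*2, b)%:R.
Proof.
rewrite -addnn -binomial.Vandermonde natr_sum; apply: eq_bigr => l _.
by rewrite /krawt expr0 mul1r coef_1DX_exp natrM bin_sub -1?ltnS.
Qed.

Lemma bin_centralS b : (b.+1 * 'C(b.+1.*2, b.+1) = 2 * b.*2.+1 * 'C(b.*2, b))%N.
Proof.
have h3 : 'C(b.*2.+1, b) = 'C(b.*2.+1, b.+1).
  by rewrite -[in RHS]bin_sub ?ltnS -?addnn ?leq_addr// subSS addnK.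
rewrite doubleS -mul_bin_diag /= h3 -doubleS -mul2n -mulnA.
by rewrite -mul_bin_diag mulnA.
Qed.

(** Ratio of super Catalan numbers in b. For j = 0 it is the ratio of central binomials; the
    parallelogram recursion then yields S(j+1,c) = (4j+2)/(j+c+1) S(j,c), which carries the ratio
    from j to j+1. *)
Lemma sqcoef_krawtSr {R : rcfType} j b :
  (j + b + 1)%:R * sqcoef (j + b.+1).+1 (krawt j b.+1) =
  (2 * b.*2.+1)%:R * sqcoef (R := R) (j + b).+1 (krawt j b).
Proof.
elim: j b => [|j IH] b.
  by rewrite !sqcoef_krawt0 -!natrM add0n addn1 bin_centralS.
have n0 c : (j + c + 1)%:R != 0 :> R by rewrite pnatr_eq0 addn1.
have S1 c : sqcoef (R := R) (j.+1 + c).+1 (krawt j.+1 c) =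
    (4 * j + 2)%:R / (j + c + 1)%:R * sqcoef (j + c).+1 (krawt j c).
  have := @sqcoef_krawt_rec R j c; have := IH c; have := n0 c.
  move: (sqcoef _ _) (sqcoef _ _) (sqcoef _ _) => x y z nc h1 h2.
  have -> : x = 4 * y - z by rewrite -h2 addrK.
  apply: (mulfI nc); rewrite mulrBr h1 !natrD !natrM -addnn -addn1 !natrD.
  by field; move: nc; rewrite !natrD.
rewrite !S1 (addSnnS j b).
have := IH b; have := n0 b; have := n0 b.+1.
move: (sqcoef _ _) (sqcoef _ _) => y z p1 p2 h.
rewrite mulrA mulrCA divff // mulr1; apply: (mulfI p2).
by rewrite mulrCA h; field.
Qed.

Lemma bin_central_le {R : rcfType} b :
  ('C(b.*2, b)%:R : R) ^+ 2 * b.+1%:R <= 16 ^+ b.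
Proof.
elim: b => [|b IH]; first by rewrite bin0 expr1n mul1r.
have h : b.+1%:R * ('C(b.+1.*2, b.+1)%:R : R) = 2 * b.*2.+1%:R * 'C(b.*2, b)%:R.
  by rewrite -!natrM bin_centralS.
have b1 : (0 : R) < b.+1%:R by [].
rewrite (exprS 16) -(ler_pM2l (exprn_gt0 3 b1)).
apply: le_trans (_ : 4 * b.*2.+1%:R ^+ 2 * b.+2%:R * 16 ^+ b <= _).
  rewrite [leLHS](_ : _ =
    (b.+1%:R * 'C(b.+1.*2, b.+1)%:R) ^+ 2 * (b.+1%:R * b.+2%:R)); last by ring.
  rewrite h (_ : (_ * _) ^+ 2 * _ =
    4 * b.*2.+1%:R ^+ 2 * b.+2%:R * ('C(b.*2, b)%:R ^+ 2 * b.+1%:R)); last by ring.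
  by rewrite ler_pM2l // !mulr_gt0 // exprn_gt0.
rewrite [leRHS]mulrA ler_pM2r ?exprn_gt0 //.
have [e1 e2 e3] : [/\ b.*2.+1%:R = 2 * b%:R + 1 :> R,
    b.+1%:R = b%:R + 1 :> R & b.+2%:R = b%:R + 2 :> R].
  by rewrite -mul2n -!natr1 natrM; split=> //; ring.
rewrite e1 e2 e3; have : (0 : R) <= b%:R by [].
move: (b%:R : R) => x x0.
by rewrite -subr_ge0 (_ : _ - _ = 12 * x + 8); [lra | ring].
Qed.

Lemma bin_central_ge {R : rcfType} b :
  16 ^+ b <= ('C(b.*2, b)%:R : R) ^+ 2 * (4 * b.+1%:R).
Proof.
(* The factor 4(b+1) does not survive the induction step; the sharper 4b+1 does. *)
apply: le_trans (_ : ('C(b.*2, b)%:R : R) ^+ 2 * (4 * b + 1)%:R <= _); last first.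
  by rewrite ler_wpM2l ?sqr_ge0// -natrM ler_nat; lia.
elim: b => [|b IH]; first by rewrite bin0 expr1n mul1r.
have h : b.+1%:R * ('C(b.+1.*2, b.+1)%:R : R) = 2 * b.*2.+1%:R * 'C(b.*2, b)%:R.
  by rewrite -!natrM bin_centralS.
have b1 : (0 : R) < b.+1%:R by [].
have b4 : (0 : R) < (4 * b + 1)%:R by rewrite ltr0n addn1.
rewrite (exprS 16) -(ler_pM2l (exprn_gt0 2 b1)) mulrA.
apply: le_trans (ler_wpM2l _ IH) _; first by rewrite mulr_ge0 // exprn_ge0 // ltW.
rewrite [leRHS]mulrA -[X in _ <= X * _]exprMn h exprMn.
rewrite [leLHS]mulrCA [leRHS]mulrAC [leRHS]mulrC ler_wpM2l ?sqr_ge0 //.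
have [e1 e2 e3] : [/\ b.*2.+1%:R = 2 * b%:R + 1 :> R,
    b.+1%:R = b%:R + 1 :> R & (4 * b.+1 + 1)%:R = 4 * b%:R + 5 :> R].
  by rewrite -mul2n natrD !natrM -!natr1 natrM; split=> //; ring.
rewrite !natrD !natrM e1 e2; have : (0 : R) <= b%:R by [].
move: (b%:R : R) => x x0.
by rewrite -subr_ge0 (_ : _ - _ = 4); [lra | ring].
Qed.

Lemma sqcoef_krawtSl {R : rcfType} j b :
  (j + b + 1)%:R * sqcoef (j.+1 + b).+1 (krawt j.+1 b) =
  (4 * j + 2)%:R * sqcoef (R := R) (j + b).+1 (krawt j b).
Proof.
have := @sqcoef_krawt_rec R j b; have := @sqcoef_krawtSr R j b.
move: (sqcoef _ _) (sqcoef _ _) (sqcoef _ _) => x y z h1 h2.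
have -> : x = 4 * y - z by rewrite -h2 addrK.
by rewrite mulrBr h1 !natrD !natrM -addnn -addn1 !natrD; ring.
Qed.

Lemma sqcoef_ge0 {R : rcfType} K (p : {poly R}) : 0 <= sqcoef K p.
Proof. by apply: sumr_ge0 => l _; exact: sqr_ge0. Qed.

(** This is S(j,b) = O(4^b (b+1)^(-j-1/2)), with the half-integer power written through a square
    root. Raising j by one costs the factor (4j+2)/(j+b+1), hence gains one power of b+1. *)
Lemma sqcoef_krawt_le {R : rcfType} j : exists2 C : R, 0 <= C & forall b,
  sqcoef (j + b).+1 (krawt j b) * Num.sqrt b.+1%:R ^+ (2 * j).+1 <= C * 4 ^+ b.
Proof.
elim: j => [|j [C C0 IH]].
  exists 1 => // b; rewrite sqcoef_krawt0 muln0 expr1 mul1r.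
  rewrite -ler_sqr ?nnegrE ?mulr_ge0 ?exprn_ge0 ?sqrtr_ge0//.
  rewrite exprMn sqr_sqrtr// exprAC (_ : 4 ^+ 2 = 16 :> R) ?bin_central_le//.
  by ring.
exists ((4 * j + 2)%:R * C); first by rewrite mulr_ge0.
move=> b; have jb : (0 : R) < (j + b + 1)%:R by rewrite ltr0n addn1.
rewrite -(ler_pM2l jb) mulrA sqcoef_krawtSl mulnS add2n 2!exprS mulrA -expr2.
rewrite sqr_sqrtr//.
have h := ler_wpM2l (ler0n R (4 * j + 2)) (IH b).
have hb : b.+1%:R <= (j + b + 1)%:R :> R by rewrite ler_nat; lia.
apply: le_trans (_ : b.+1%:R * ((4 * j + 2)%:R * (C * 4 ^+ b)) <= _).
  apply: le_trans (ler_wpM2l (ler0n R b.+1) h).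
  move: (sqcoef _ _) (Num.sqrt _ ^+ _) => x y.
  by rewrite le_eqVlt; apply/orP; left; apply/eqP; ring.
rewrite -[X in _ <= _ * X]mulrA ler_wpM2r// !mulr_ge0 ?exprn_ge0//.
Qed.

(** * Interpolation in the operator N - 2x d/dx *)

(** By the product rule, splitting N = k+b: the k terms carry 1-x+2x = 1+x and the b terms carry
    1+x-2x = 1-x. The truncated predecessors at k = 0 or b = 0 have coefficient zero. *)
Lemma krawt_euler {R : rcfType} k b l :
  ((k + b)%:R - 2 * l%:R) * (krawt (R := R) k b)`_l =
  k%:R * (krawt k.-1 b.+1)`_l + b%:R * (krawt k.+1 b.-1)`_l.
Proof.
have d1 : (1 - 'X : {poly R})^`() = -1 by rewrite derivB derivX derivC sub0r.
have d2 : (1 + 'X : {poly R})^`() = 1 by rewrite derivD derivX derivC add0r.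
have E : (k + b)%:R * krawt (R := R) k b - 2 * ('X * (krawt k b)^`()) =
    k%:R * krawt k.-1 b.+1 + b%:R * krawt k.+1 b.-1.
  rewrite /krawt derivM !deriv_exp d1 d2.
  by case: k b => [|k] [|b] /=; rewrite ?exprS ?expr0 ?addn0 ?add0n; ring.
have := congr1 (fun p : {poly R} => p`_l) E.
rewrite coefB coefD -!polyC_natr !coefCM => <-.
rewrite mulrBl -mulrA; congr (_ - 2 * _).
by rewrite coefXM coef_deriv; case: l => [|l]; rewrite ?mul0r//= mulr_natl.
Qed.

Lemma sqcoef_lincomb3 {R : rcfType} K (a b c : R) (f g h : {poly R}) :
  sqcoef K (a *: f + b *: g - c *: h) <=
  3 * (a ^+ 2 * sqcoef K f + b ^+ 2 * sqcoef K g + c ^+ 2 * sqcoef K h).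
Proof.
rewrite /sqcoef !mulr_sumr -!big_split /= mulr_sumr; apply: ler_sum => l _.
rewrite coefB coefD !coefZ -!exprMn.
move: (a * _) (b * _) (c * _) => x y z; rewrite -subr_ge0.
rewrite (_ : _ - _ = (x - y) ^+ 2 + (x + z) ^+ 2 + (y + z) ^+ 2); last by ring.
by rewrite !addr_ge0 ?sqr_ge0.
Qed.

(* Coefficient [l] of the image of [krawt k _] (of total degree [N = 2n + q])
   under the product of the operators [N - 2x d/dx - c] is
   [\prod_c (N - 2l - c)] times coefficient [l] of [krawt k _]; by
   [krawt_euler] this image is still divisible by [(1 + x)^n]. *)
Lemma krawt_prod {R : rcfType} q (cs : seq R) k : (k + size cs <= q)%N ->
  exists2 C : R, 0 <= C & forall n, exists g : {poly R},
    [/\ (size g <= (q + n).+1)%N,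
        forall l, ((1 + 'X) ^+ n * g)`_l =
          (\prod_(c <- cs) ((n.*2 + q)%:R - 2 * l%:R - c)) *
          (krawt k (n.*2 + q - k))`_l
      & sqcoef (q + n).+1 g * Num.sqrt n.+1%:R ^+ (2 * k).+1 <=
        C * 4 ^+ n * n.+1%:R ^+ size cs].
Proof.
elim: cs k => [|c cs IH] k.
  rewrite addn0 => kq; have [C C0 hC] := @sqcoef_krawt_le R k.
  exists (C * 4 ^+ (q - k)); first by rewrite mulr_ge0 ?exprn_ge0.
  move=> n; exists (krawt k (n + (q - k))).
  have e : (k + (n + (q - k)) = q + n)%N by lia.
  split.
  - by rewrite -e size_krawt.
  - move=> l; rewrite big_nil mul1r; congr (_ `_ l).
    have -> : (n.*2 + q - k = n + (n + (q - k)))%N by lia.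
    by rewrite /krawt mulrCA -exprD.
  - rewrite expr0 mulr1 -e -mulrA -exprD [(q - k + n)%N]addnC.
    apply: le_trans (hC _); rewrite ler_wpM2l ?sqcoef_ge0//.
    rewrite lerXn2r ?nnegrE ?sqrtr_ge0// ler_wsqrtr// ler_nat; lia.
move=> kq.
(* Applying one operator factor moves k by at most one, so removing [c] from the list pays for the
   step up to [k.+1]. *)
have [C2 C20 h2] := IH k.+1 ltac:(move: kq => /=; lia).
have [C3 C30 h3] := IH k ltac:(move: kq => /=; lia).
have [C1 C10 h1] := IH k.-1 ltac:(move: kq => /=; lia).
exists (3 * (k%:R ^+ 2 * C1 + q.+2%:R ^+ 2 * C2 + c ^+ 2 * C3)).
  by rewrite mulr_ge0// !addr_ge0// mulr_ge0// sqr_ge0.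
move=> n; have [g1 [s1 e1 b1]] := h1 n; have [g2 [s2 e2 b2]] := h2 n.
have [g3 [s3 e3 b3]] := h3 n.
exists (k%:R *: g1 + (n.*2 + q - k)%:R *: g2 - c *: g3); split.
- apply: leq_trans (size_polyD _ _) _; rewrite size_polyN geq_max.
  rewrite (leq_trans (size_scale_leq _ _) s3) andbT.
  apply: leq_trans (size_polyD _ _) _; rewrite geq_max.
  by rewrite !(leq_trans (size_scale_leq _ _)).
- move=> l; rewrite mulrBr mulrDr -!scalerAr coefB coefD !coefZ e1 e2 e3.
  rewrite big_cons.
  have := @krawt_euler R k (n.*2 + q - k) l.
  have kk : (k + (n.*2 + q - k) = n.*2 + q)%N by move: kq => /=; lia.
  rewrite kk (_ : (n.*2 + q - k).-1 = n.*2 + q - k.+1)%N; last by lia.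
  (* At k = 0 the two polynomials differ, but both are multiplied by zero. *)
  have -> : k%:R * (krawt (R := R) k.-1 (n.*2 + q - k).+1)`_l =
            k%:R * (krawt k.-1 (n.*2 + q - k.-1))`_l.
    case: k {h1 h2 h3 e1 e2 e3 b1 b2 b3} kq kk => [|k] /= kq kk; first by rewrite !mul0r.
    by rewrite (_ : (n.*2 + q - k.+1).+1 = n.*2 + q - k)%N //; lia.
  move: (\prod_(_ <- _) _) => P.
  move: (krawt k.-1 _)`_l (krawt k.+1 _)`_l (krawt k _)`_l => x y z.
  set A := (_ - 2 * _) => E.
  by transitivity (P * (A * z) - c * (P * z)); [rewrite E|]; ring.
- set s := Num.sqrt _ in b1 b2 b3 *.
  have s0 : 0 <= s by exact: sqrtr_ge0.
  have ss : s ^+ 2 = n.+1%:R by rewrite sqr_sqrtr.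
  apply: le_trans (ler_wpM2r (exprn_ge0 _ s0) (sqcoef_lincomb3 _ _ _ _ _ _ _)) _.
  (* Each term may lose one factor n+1. The k-1 term lacks two powers of [s]; the k+1 term has a
     squared coefficient of order (n+1)^2 but two powers of [s] to spare; for the [c] term, n+1 >= 1
     suffices. *)
  pose T : R := 4 ^+ n * n.+1%:R ^+ (size cs).+1.
  have T0 : 0 <= 4 ^+ n * n.+1%:R ^+ size cs :> R by rewrite mulr_ge0 ?exprn_ge0.
  have n1 : 1 <= n.+1%:R :> R by rewrite ler1n.
  have B1 : k%:R ^+ 2 * sqcoef (q + n).+1 g1 * s ^+ (2 * k).+1 <= k%:R ^+ 2 * C1 * T.
    case: k {h1 h2 h3 e1 e2 e3 b2 b3} kq b1 => [|k] /= kq b1.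
      by rewrite expr0n !mul0r.
    rewrite -[leLHS]mulrA -[leRHS]mulrA ler_wpM2l ?sqr_ge0//.
    have -> : s ^+ (2 * k.+1).+1 = s ^+ (2 * k).+1 * n.+1%:R.
      by rewrite mulnS -(addnS 2) exprD ss mulrC.
    rewrite mulrA; apply: le_trans (ler_wpM2r (ler0n R n.+1) b1) _.
    by rewrite /T exprSr !mulrA.
  have B2 : (n.*2 + q - k)%:R ^+ 2 * sqcoef (q + n).+1 g2 * s ^+ (2 * k).+1 <=
            q.+2%:R ^+ 2 * C2 * T.
    have : (n.*2 + q - k)%:R <= q.+2%:R * n.+1%:R :> R.
      rewrite -natrM ler_nat (leq_trans (leq_subr _ _))// mulnS addnC.
      by rewrite -muln2 mulnC leq_add ?leq_mul// leqW// leqW.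
    rewrite -ler_sqr ?nnegrE ?mulr_ge0// exprMn => hN.
    rewrite -mulrA.
    apply: le_trans (ler_wpM2r _ hN) _; first by rewrite mulr_ge0 ?sqcoef_ge0 ?exprn_ge0.
    rewrite -[leLHS]mulrA -[leRHS]mulrA ler_wpM2l ?sqr_ge0//.
    have -> : n.+1%:R ^+ 2 * (sqcoef (q + n).+1 g2 * s ^+ (2 * k).+1) =
        sqcoef (q + n).+1 g2 * s ^+ (2 * k.+1).+1 * n.+1%:R.
      by rewrite mulnS -(addnS 2) exprD ss; ring.
    apply: le_trans (ler_wpM2r (ler0n R n.+1) b2) _.
    by rewrite /T exprSr !mulrA.
  have B3 : c ^+ 2 * sqcoef (q + n).+1 g3 * s ^+ (2 * k).+1 <= c ^+ 2 * C3 * T.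
    rewrite -[leLHS]mulrA -[leRHS]mulrA ler_wpM2l ?sqr_ge0//; apply: le_trans b3 _.
    rewrite -mulrA ler_wpM2l// /T exprSr mulrA ler_peMr//.
  rewrite [leRHS](_ : _ = 3 * (k%:R ^+ 2 * C1 * T + q.+2%:R ^+ 2 * C2 * T
    + c ^+ 2 * C3 * T)); last by rewrite /T /=; ring.
  by rewrite -[leLHS]mulrA ler_wpM2l// !mulrDl !lerD.
Qed.

(** Bounds from below the coefficient by which the interpolation divides: Pascal's rule along the
    diagonal, then monotonicity in the upper index. *)
Lemma bin_center_shift_ge n q i : (i <= q)%N ->
  ('C(n.*2, n) <= 'C(n.*2 + q, n + i))%N.
Proof.
move=> iq; apply: (@leq_trans 'C(n.*2 + i, n + i)).
  elim: i {iq} => [|i IH]; first by rewrite !addn0.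
  by rewrite !addnS (leq_trans IH)// binS leq_addl.
by rewrite leq_bin2l// leq_add2l.
Qed.

(* The polynomial is [(1 + x)^n g = l(N - 2x d/dx) (1 + x)^N] up to a scalar,
   with [N = 2n + q], where [l] vanishes at [N - 2(n + t)] for [t <= q],
   [t != i]; the values of [l] that matter do not depend on [n]. *)
Lemma krawt_right_inverse {R : rcfType} q i : (i <= q)%N ->
  exists2 C : R, 0 <= C & forall n, exists g : {poly R},
    [/\ (size g <= (q + n).+1)%N,
        forall t, (t <= q)%N -> ((1 + 'X) ^+ n * g)`_(n + t) = (t == i)%:R
      & sqcoef (q + n).+1 g * 4 ^+ n <= C * Num.sqrt n.+1%:R ^+ (2 * q).+1].
Proof.
move=> iq; pose ts := rem i (iota 0 q.+1).
have ii : i \in iota 0 q.+1 by rewrite mem_iota add0n ltnS.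
have tsE t : (t \in ts) = (t != i) && (t <= q)%N.
  by rewrite mem_rem_uniq ?iota_uniq// inE mem_iota add0n ltnS.
pose cs : seq R := [seq q%:R - 2 * t%:R | t <- ts].
have scs : size cs = q by rewrite size_map size_rem// size_iota.
have [C0 C00 hC] := @krawt_prod R q cs 0 ltac:(by rewrite scs).
pose kap : R := \prod_(t <- ts) (2 * (t%:R - i%:R)).
have kap0 : kap != 0.
  rewrite prodf_seq_neq0; apply/allP => t; rewrite tsE => /andP[ti _].
  by rewrite mulf_neq0 ?pnatr_eq0// subr_eq0 eqr_nat.
exists (4 * C0 / kap ^+ 2).
  by rewrite divr_ge0 ?sqr_ge0// mulr_ge0.
move=> n; have [g [sg eg bg]] := hC n.
pose b : R := 'C(n.*2 + q, n + i)%:R.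
have b0 : 0 < b by rewrite ltr0n bin_gt0 -addnn -addnA leq_add2l (leq_trans iq)// leq_addl.
(* Before scaling, coefficient n+i of (1+x)^n g is [kap * b]: [kap] is the interpolation product at
   t = i and [b] is the coefficient of (1+x)^N there. *)
exists ((kap * b)^-1 *: g); split.
- exact: leq_trans (size_scale_leq _ _) sg.
- move=> t tq; rewrite -scalerAr coefZ eg subn0 /krawt expr0 mul1r coef_1DX_exp.
  rewrite big_map.
  have -> : \prod_(j <- ts) ((n.*2 + q)%:R - 2 * (n + t)%:R - (q%:R - 2 * j%:R)) =
      \prod_(j <- ts) (2 * (j%:R - t%:R)) :> R.
    by apply: eq_bigr => j _; rewrite !natrD -mul2n natrM; ring.
  have [->|ti] := eqVneq t i; first by rewrite mulVf// mulf_neq0// gt_eqF.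
  rewrite (big_rem t) /=; last by rewrite tsE ti.
  by rewrite subrr mulr0 !mul0r mulr0.
- set s := Num.sqrt _ in bg *.
  have ss : s ^+ 2 = n.+1%:R by rewrite sqr_sqrtr.
  have s0 : 0 < s by rewrite sqrtr_gt0.
  (* The division by b^2 absorbs two factors 4^n, one from the bound on [g] and one from the claim,
     at the price of 4 s^2. *)
  have hb : 16 ^+ n <= b ^+ 2 * (4 * s ^+ 2).
    rewrite ss; apply: le_trans (bin_central_ge n) _.
    by rewrite ler_wpM2r// lerXn2r ?nnegrE// ler_nat bin_center_shift_ge.
  have -> : sqcoef (q + n).+1 ((kap * b)^-1 *: g) =
      (kap ^+ 2)^-1 * ((b ^+ 2)^-1 * sqcoef (q + n).+1 g).
    rewrite /sqcoef !mulr_sumr; apply: eq_bigr => l _.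
    by rewrite coefZ exprMn invfM exprMn !exprVn mulrA.
  rewrite -[leLHS]mulrA [4 * C0 / _]mulrC -[leRHS]mulrA ler_wpM2l ?invr_ge0 ?sqr_ge0//.
  rewrite -[leLHS]mulrA ler_pdivrMl ?exprn_gt0// -(ler_pM2r s0).
  rewrite scs -ss -exprM in bg; rewrite mulrAC.
  rewrite mulrAC in bg.
  apply: le_trans (ler_wpM2r _ bg) _; first by rewrite exprn_ge0.
  apply: le_trans (_ : C0 * s ^+ (2 * q) * 16 ^+ n <= _).
    have -> : 16 ^+ n = 4 ^+ n * 4 ^+ n :> R by rewrite -exprMn; congr (_ ^+ _); ring.
    by rewrite le_eqVlt; apply/orP; left; apply/eqP; ring.
  apply: le_trans (ler_wpM2l _ hb) _; first by rewrite mulr_ge0// exprn_ge0// ltW.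
  rewrite (exprS s (2 * q)); move: (s ^+ (2 * q)) => u.
  by rewrite le_eqVlt; apply/orP; left; apply/eqP; ring.
Qed.

(** * Cauchy-Schwarz for real coefficients and complex values *)

(** The sum of the squares (a_l S - b_l A)^2 is nonnegative and equals A times the defect of the
    inequality; if A = 0, all a_l vanish. *)
Lemma sum_CauchySchwarz {R : realFieldType} K (a b : 'I_K -> R) :
  (\sum_l a l * b l) ^+ 2 <= (\sum_l a l ^+ 2) * (\sum_l b l ^+ 2).
Proof.
set A := \sum_l a l ^+ 2; set S := \sum_l a l * b l.
have A0 : 0 <= A by apply: sumr_ge0 => l _; exact: sqr_ge0.
have : 0 <= \sum_l (a l * S - b l * A) ^+ 2 by apply: sumr_ge0 => l _; exact: sqr_ge0.
have -> : \sum_l (a l * S - b l * A) ^+ 2 = A * (A * (\sum_l b l ^+ 2) - S ^+ 2).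
  transitivity (\sum_l (S ^+ 2 * a l ^+ 2 - 2 * S * A * (a l * b l) + A ^+ 2 * b l ^+ 2)).
    by apply: eq_bigr => l _; ring.
  by rewrite big_split sumrB -!mulr_sumr -/A -/S /=; ring.
have [A1|A1] := ltP 0 A; first by rewrite pmulr_rge0// subr_ge0.
have AE : A = 0 by apply/eqP; rewrite eq_le A1.
suff -> : S = 0 by rewrite AE !mul0r expr0n.
apply: big1 => l _; move: AE => /psumr_eq0P al.
by have /eqP := al (fun l _ => sqr_ge0 _) l isT; rewrite sqrf_eq0 => /eqP ->; rewrite mul0r.
Qed.

Lemma normc_sum {R : realType} K (c : 'I_K -> R[i]) :
  normc (\sum_l c l) <= \sum_l normc (c l).
Proof. by rewrite -lecR rmorph_sum; exact: (@ler_norm_sum _ R[i]). Qed.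

Lemma normc_realM {R : realType} (x : R) (z : R[i]) :
  normc (x%:C * z) = `|x| * normc z.
Proof. by rewrite normcM /= expr0n addr0 sqrtr_sqr. Qed.

Lemma sqcoef_CauchySchwarz {R : realType} K (p : {poly R}) (c : nat -> R[i]) :
  normc (\sum_(l < K) (p`_l)%:C * c l) ^+ 2 <=
  sqcoef K p * \sum_(l < K) normc (c l) ^+ 2.
Proof.
apply: (@le_trans _ _ ((\sum_(l < K) `|p`_l| * normc (c l)) ^+ 2)).
  have h0 : 0 <= \sum_(l < K) `|p`_l| * normc (c l).
    by apply: sumr_ge0 => l _; rewrite mulr_ge0// normc_ge0.
  rewrite ler_sqr ?nnegrE ?normc_ge0//. 
  apply: le_trans (@normc_sum R K (fun l => (p`_l)%:C * c l)) _.
  by apply: ler_sum => l _; rewrite normc_realM.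
apply: le_trans (sum_CauchySchwarz _ _ _) _.
rewrite ler_wpM2r//; first by apply: sumr_ge0 => l _; exact: sqr_ge0.
by apply: ler_sum => l _; rewrite real_normK// num_real.
Qed.

Lemma normc_indic {R : realType} (b : bool) : normc (b%:R : R[i]) ^+ 2 = b%:R.
Proof. by case: b; rewrite ?normc1 ?normc0 ?expr1n ?expr0n. Qed.

(** * Levels and finitely supported vectors of the weighted space *)

Section WeightedLattice.
Context {R : realType} {omega : nat -> R[i]} {omega0 : forall n, omega n != 0}.
Local Notation X := (ell2 (level_weight_neq0 omega0)).
Local Notation mu := (level_weight omega).

Lemma ell2_norm_ltP (x : X) (e : R) : `|x| < e%:C = (ell2_rnorm x < e).
Proof. by rewrite ltcR. Qed.

Definition level (m : nat) : set (nat * nat) := [set v | (v.1 + v.2)%N = m].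

Lemma esum_level m (a : nat * nat -> R) : (forall v, 0 <= a v) ->
  (\esum_(v in level m) (a v)%:E = (\sum_(l < m.+1) a (l : nat, m - l)%N)%:E)%E.
Proof.
move=> a0; have -> : level m = (fun l => (l, m - l)%N) @` `I_m.+1.
  apply/seteqP; split => [[i j] /= <-|_ [l /= lm <-]].
    by exists i; rewrite /= ?ltnS ?leq_addr// addKn.
  by rewrite /level /= subnKC.
rewrite esum_image; last by move=> i j _ _ [].
rewrite esum_fset//; last by move=> i _; rewrite lee_fin.
by rewrite -sumEFin -fsbig_ord.
Qed.

Lemma level_norm_le (x : X) m :
  normc (omega m) ^+ 2 * \sum_(l < m.+1) normc (x (l : nat, m - l)%N) ^+ 2 <=
  ell2_rnorm x ^+ 2.
Proof.
rewrite -lee_fin -ell2_sqnormE mulr_sumr.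
pose a v := normc (mu v * x v) ^+ 2.
have -> : \sum_(l < m.+1) normc (omega m) ^+ 2 * normc (x (l : nat, m - l)%N) ^+ 2 =
    \sum_(l < m.+1) a (l : nat, m - l)%N.
  apply: eq_bigr => l _; rewrite /a normcM exprMn /level_weight /=.
  by rewrite subnKC// -ltnS.
rewrite -esum_level; last by move=> v; exact: sqr_ge0.
rewrite esum_mkcond; apply: le_esum => v _.
by case: ifP => _ //; rewrite lee_fin sqr_ge0.
Qed.

Definition level_fun (m : nat) (c : nat -> R[i]) (v : nat * nat) : R[i] :=
  if (v.1 + v.2 == m)%N then c v.1 else 0.

Lemma level_fun_sqnorm m c : ell2_sqnorm mu (level_fun m c) =
  (normc (omega m) ^+ 2 * \sum_(l < m.+1) normc (c l) ^+ 2)%:E.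
Proof.
pose a (v : nat * nat) := normc (omega m) ^+ 2 * normc (c v.1) ^+ 2.
rewrite mulr_sumr -(@esum_level m a); last first.
  by move=> v; rewrite mulr_ge0 ?sqr_ge0.
rewrite esum_mkcond; apply: eq_esum => v _; rewrite /level_fun /level_weight.
case: eqP => [e|ne].
  by rewrite mem_set// e normcM exprMn.
by rewrite memNset// mulr0 normc0 expr0n.
Qed.

Lemma level_funP m c : level_fun m c \in ell2_pred mu.
Proof. by apply: mem_set; rewrite /= level_fun_sqnorm ltry. Qed.

Definition level_vec m c : X := Ell2 (level_weight_neq0 omega0) (level_funP m c).

Lemma level_vec_norm m c : ell2_rnorm (level_vec m c) ^+ 2 =
  normc (omega m) ^+ 2 * \sum_(l < m.+1) normc (c l) ^+ 2.
Proof. by apply: EFin_inj; rewrite -ell2_sqnormE level_fun_sqnorm. Qed.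

Lemma ell2_rnormD (x y : X) : ell2_rnorm (x + y) <= ell2_rnorm x + ell2_rnorm y.
Proof. by rewrite -lecR rmorphD; exact: ell2_normD. Qed.

Lemma ell2_ball_open (U : set X) x : open U -> U x ->
  exists2 e : R, 0 < e & forall y, ell2_rnorm (x - y) < e -> U y.
Proof.
move=> oU Ux; have /nbhs_ballP[e /= e0 he] := open_nbhs_nbhs (conj oU Ux).
(* Radii of balls are positive elements of [R[i]], hence real. *)
have eE : e = (complex.Re e)%:C by rewrite RRe_real// gtr0_real.
exists (complex.Re e); first by rewrite -ltcR -eE.
move=> y xy; apply: he; rewrite -ball_normE /= eE.
by rewrite ell2_norm_ltP.
Qed.

(** The squared norm is a supremum of finite sums, so some finite set carries all but e^2 of it; [y]
    is [x] restricted to that set. *)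
Lemma ell2_finite_approx (x : X) (e : R) : 0 < e -> exists (y : X) (L : nat),
  (forall v, (L < v.1 + v.2)%N -> y v = 0) /\ ell2_rnorm (x - y) < e.
Proof.
move=> e0; pose a v := normc (mu v * x v) ^+ 2.
have a0 v : (0 <= (a v)%:E)%E by rewrite lee_fin sqr_ge0.
have [|_ [A [finA _] <-]] := @ub_ereal_sup_adherent _
    [set (\sum_(v \in A) (a v)%:E)%E | A in fsets [set: nat * nat]] (e ^+ 2) (exprn_gt0 2 e0).
  by rewrite -/(esum _ _) -/(ell2_sqnorm mu x) ell2_sqnormE.
rewrite -/(esum _ _) -/(ell2_sqnorm mu x) ell2_sqnormE => hA.
pose yf v := if v \in A then x v else 0.
have yfP : yf \in ell2_pred mu.
  apply: mem_set => /=; apply: (@le_lt_trans _ _ (ell2_sqnorm mu x)).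
    apply: le_esum => v _; rewrite /yf; case: ifP => // _.
    by rewrite mulr0 normc0 expr0n lee_fin sqr_ge0.
  by rewrite ell2_sqnormE ltry.
pose y : X := Ell2 (level_weight_neq0 omega0) yfP.
have /finite_seqP[s As] := finA.
exists y, (\max_(v <- s) (v.1 + v.2))%N; split.
  move=> v; rewrite ltnNge => vL; rewrite /= /yf; case: ifP => // vA.
  case/negP: vL.
  apply: (@leq_bigmax_seq _ s predT (fun v => v.1 + v.2)%N) => //.
  by move: vA; rewrite As inE.
have xyE : ell2_sqnorm mu (x - y) = (\esum_(v in [set: nat * nat] `&` ~` A) (a v)%:E)%E.
  rewrite setTI [RHS]esum_mkcond; apply: eq_esum => v _.
  have -> : (x - y) v = if v \in A then 0 else x v.
    have -> : (x - y) v = x v - yf v by [].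
    by rewrite /yf; case: ifP; rewrite ?subrr ?subr0.
  by rewrite in_setC; case: (v \in A) => //=; rewrite mulr0 normc0 expr0n.
have : ell2_sqnorm mu x = (\sum_(v \in A) (a v)%:E + ell2_sqnorm mu (x - y)%R)%E.
  rewrite xyE /ell2_sqnorm (esumID A); last by move=> v _; exact: a0.
  by rewrite !setTI esum_fset// => v _; exact: a0.
rewrite !ell2_sqnormE.
move: hA; case: (\sum_(v \in A) (a v)%:E)%E => //= r hA [hr].
rewrite -ltr_sqr ?nnegrE ?ell2_rnorm_ge0 ?ltW//.
by move: hA; rewrite -EFinB lte_fin hr; lra.
Qed.

Lemma ell2_ext (f g : X) : (forall i j, f (i, j) = g (i, j)) -> f = g.
Proof. by move=> fg; apply: val_inj; apply/funext => -[i j] /=. Qed.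

Lemma ell2_subE (f g : X) v : (f - g) v = f v - g v.
Proof. by []. Qed.

Lemma ell2_scaleE (c : R[i]) (f : X) v : (c *: f) v = c * f v.
Proof. by []. Qed.

Lemma ell2_sumE (I : Type) (r : seq I) (F : I -> X) v :
  (\sum_(i <- r) F i) v = \sum_(i <- r) F i v.
Proof. by apply: (big_morph (fun f : X => f v)). Qed.

Lemma level_unit_sqnorm m i : (i <= m)%N ->
  ell2_rnorm (level_vec m (fun l => (l == i)%:R)) ^+ 2 = normc (omega m) ^+ 2.
Proof.
move=> im; rewrite level_vec_norm (bigD1 (Ordinal (im : (i < m.+1)%N)))//= eqxx.
rewrite normc_indic big1 ?addr0 ?mulr1// => l li.
by rewrite normc_indic (_ : (l == i :> nat) = false)//; apply/negbTE.
Qed.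

Lemma ell2_level_decomposition (g : X) L :
  (forall v, (L < v.1 + v.2)%N -> g v = 0) ->
  g = \sum_(q < L.+1) \sum_(i < q.+1)
        g (i : nat, q - i)%N *: level_vec q (fun l => (l == i :> nat)%:R).
Proof.
move=> gL; apply: ell2_ext => k j; rewrite ell2_sumE.
have E (q : 'I_L.+1) : (\sum_(i < q.+1)
    g (i : nat, q - i)%N *: level_vec q (fun l => (l == i :> nat)%:R)) (k, j) =
    if q == (k + j)%N :> nat then g (k, j) else 0.
  rewrite ell2_sumE; under eq_bigr do rewrite ell2_scaleE.
  case: eqP => [e|ne].
    have kq : (k < q.+1)%N by rewrite ltnS e leq_addr.
    rewrite (bigD1 (Ordinal kq))//= big1 ?addr0 => [|i ik].
      by rewrite /level_fun /= e !eqxx mulr1 addKn.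
    rewrite /level_fun /= -e eqxx.
    by rewrite (_ : (k == i :> nat) = false) ?mulr0//; apply/negbTE; rewrite eq_sym.
  apply: big1 => i _; rewrite /= /level_fun /=.
  by rewrite ifN ?mulr0//; apply/eqP => e; case: ne.
under eq_bigr do rewrite E.
have [kjL|kjL] := leqP (k + j) L.
  have kj : (k + j < L.+1)%N by rewrite ltnS.
  rewrite (bigD1 (Ordinal kj))//= eqxx big1 ?addr0// => q qkj.
  by rewrite (_ : (q == (k + j)%N :> nat) = false)//; apply/negbTE.
by rewrite gL// big1// => q _; case: eqP.
Qed.

Lemma ell2_ballE (x : X) (d : R) y : ball x d%:C y = (ell2_rnorm (x - y) < d) :> Prop.
Proof. by rewrite -ball_normE /= ell2_norm_ltP. Qed.

Lemma ell2_ball_center (x : X) (d : R) : 0 < d -> ball x d%:C x.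
Proof. by move=> d0; apply: ballxx; rewrite ltcR. Qed.

End WeightedLattice.

(** * The weight quantity of assertion (iii) *)

Definition scaled_weight {R : realType} (omega : nat -> R[i]) q n : R :=
  normc (omega (q + n)%N) / normc (omega q) *
  ((n.+1%:R `^ (q%:R / 2 + 1 / 4)) / 2 ^+ n).

Lemma powR_half_quarter_sqr {R : realType} (x : R) q : 0 < x ->
  (x `^ (q%:R / 2 + 1 / 4)) ^+ 2 = Num.sqrt x ^+ (2 * q).+1.
Proof.
move=> x0; rewrite -powR_mulrn ?powR_ge0// -powRrM.
rewrite -powR12_sqrt ?ltW// -powR_mulrn ?powR_ge0// -powRrM.
have -> : (2 * q).+1%:R = 2 * q%:R + 1 :> R by rewrite -addn1 natrD natrM.
by congr (_ `^ _); field.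
Qed.

Lemma sqr_scaled_weight {R : realType} (omega : nat -> R[i]) q n :
  scaled_weight omega q n ^+ 2 =
  normc (omega (q + n)%N) ^+ 2 / normc (omega q) ^+ 2 *
  (Num.sqrt n.+1%:R ^+ (2 * q).+1 / 4 ^+ n).
Proof.
rewrite /scaled_weight !exprMn !exprVn powR_half_quarter_sqr//.
by rewrite exprAC (_ : 2 ^+ 2 = 4 :> R)//; ring.
Qed.

Lemma normc_gt0 {R : realType} (z : R[i]) : z != 0 -> 0 < normc z.
Proof.
by move=> z0; rewrite lt_neqAle normc_ge0 andbT eq_sym; apply: contra_neq z0 => /eq0_normc.
Qed.

Lemma scaled_weight_gt0 {R : realType} (omega : nat -> R[i]) q n :
  (forall n, omega n != 0) -> 0 < scaled_weight omega q n.
Proof.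
by move=> omega0; rewrite /scaled_weight mulr_gt0 ?divr_gt0 ?normc_gt0.
Qed.

Lemma scaled_weight0 {R : realType} (omega : nat -> R[i]) q :
  (forall n, omega n != 0) -> scaled_weight omega q 0 = 1.
Proof.
move=> omega0; rewrite /scaled_weight addn0 divff ?gt_eqF ?normc_gt0//.
by rewrite powR1 expr0 divr1 mulr1.
Qed.

(** Choosing a threshold below this bound forces n > K whenever [a n] is below the threshold. *)
Lemma pos_lower_bound {R : realDomainType} (a : nat -> R) K :
  (forall n, 0 < a n) -> exists2 d, 0 < d & forall n, (n <= K)%N -> d <= a n.
Proof.
move=> a0; elim: K => [|K [d d0 IH]].
  by exists (a 0); rewrite ?a0// => n; rewrite leqn0 => /eqP ->.
exists (Num.min d (a K.+1)); first by rewrite lt_min d0 a0.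
move=> n; rewrite leq_eqVlt => /orP[/eqP ->|nK]; first by rewrite ge_min lexx orbT.
by rewrite ge_min IH.
Qed.

(** * Powers of the shift as polynomial multiplication *)

Section Shift.
Context {R : realType} {omega : nat -> R[i]} {omega0 : forall n, omega n != 0}.
Local Notation X := (ell2 (level_weight_neq0 omega0)).
Local Notation levelv := (level_vec (omega0 := omega0)).
Context {B : {linear X -> X}}.
Hypothesis B_shift : forall f, B f = lattice_shift f :> (nat * nat -> R[i]).
Local Notation w := (scaled_weight omega).

Lemma shiftE (f : X) i j : B f (i, j) = f (i.+1, j) + f (i, j.+1).
Proof.
by rewrite B_shift /lattice_shift /lattice_children big_cons big_seq1.
Qed.

Lemma iter_shift_vanish n (f : X) : (forall v, (n <= v.1 + v.2)%N -> f v = 0) ->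
  iter n B f = 0.
Proof.
elim: n f => [|n IH] f f0; first by apply: ell2_ext => i j; rewrite /= f0.
rewrite iterSr IH// => -[i j] /= ij.
by rewrite shiftE !f0 ?addr0//= addnS.
Qed.

(** One shift gives g_(i+1) + g_i, which is coefficient i+1 of (1+x) g; the index therefore advances
    by one at each application. *)
Lemma iter_shift_level_vec n m (g : {poly R}) i j :
  iter n B (levelv m (fun l => (g`_l)%:C)) (i, j) =
  if (i + j + n == m)%N then (((1 + 'X) ^+ n * g)`_(n + i))%:C else 0.
Proof.
elim: n i j => [|n IH] i j; first by rewrite /= /level_fun /= addn0 mul1r.
rewrite iterS shiftE !IH !addnS !addSn; case: ifP => _; last by rewrite addr0.
by rewrite -rmorphD exprS -mulrA mulrDl mul1r coefD coefXM.
Qed.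

(** Under the pairing without weights or conjugation, [B] from level q+1 to level q is adjoint to
    multiplication by 1+x. *)
Lemma shift_adjoint q (p : {poly R}) (f : X) : (size p <= q.+1)%N ->
  \sum_(i < q.+1) (p`_i)%:C * B f (i : nat, q - i)%N =
  \sum_(l < q.+2) (((1 + 'X) * p)`_l)%:C * f (l : nat, q.+1 - l)%N.
Proof.
move=> sp.
under eq_bigr do rewrite shiftE mulrDr.
under [RHS]eq_bigr do rewrite mulrDl mul1r coefD rmorphD mulrDl /=.
rewrite !big_split /= [RHS]addrC; congr (_ + _).
  rewrite [RHS]big_ord_recl coefXM /= mul0r add0r.
  by apply: eq_bigr => l _; rewrite coefXM.
rewrite [RHS]big_ord_recr /= nth_default// mul0r addr0.
by apply: eq_bigr => l _; rewrite subSn// -ltnS.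
Qed.

Lemma iter_shift_adjoint n q (p : {poly R}) (f : X) : (size p <= q.+1)%N ->
  \sum_(i < q.+1) (p`_i)%:C * iter n B f (i : nat, q - i)%N =
  \sum_(l < (q + n).+1) (((1 + 'X) ^+ n * p)`_l)%:C * f (l : nat, q + n - l)%N.
Proof.
elim: n q p f => [|n IH] q p f sp; first by rewrite addn0 mul1r.
rewrite iterS shift_adjoint// IH; last first.
  apply: leq_trans (size_polyMleq _ _) _.
  have : (size (1 + 'X : {poly R})%R <= 2)%N by rewrite addrC -polyC1 size_XaddC.
  by move: sp; case: (size _) => [|[|[|k]]] //=; rewrite ?add0n ?addSn; lia.
rewrite addSnnS; apply: eq_bigr => l _.
by rewrite mulrA -exprSr.
Qed.

Lemma shift_right_inverse q i : (i <= q)%N -> exists2 C : R, 0 <= C &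
  forall n, exists2 h : X, iter n B h = levelv q (fun l => (l == i)%:R) &
    ell2_rnorm h ^+ 2 * 4 ^+ n <=
    C * normc (omega (q + n)%N) ^+ 2 * Num.sqrt n.+1%:R ^+ (2 * q).+1.
Proof.
move=> iq; have [C C0 hC] := @krawt_right_inverse R q i iq; exists C => // n.
have [g [sg eg bg]] := hC n.
exists (levelv (q + n) (fun l => (g`_l)%:C)).
  apply: ell2_ext => k j; rewrite iter_shift_level_vec eqn_add2r /= /level_fun /=.
  case: eqP => // kj; rewrite eg; last by rewrite -kj leq_addr.
  by case: eqP.
rewrite level_vec_norm -[leLHS]mulrA [C * _]mulrC -[leRHS]mulrA.
rewrite ler_wpM2l ?sqr_ge0//.
have -> : \sum_(l < (q + n).+1) normc (g`_l)%:C ^+ 2 = sqcoef (q + n).+1 g; last exact: bg.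
apply: eq_bigr => l _; rewrite -[_%:C]mulr1 normc_realM normc1 mulr1.
by rewrite real_normK// num_real.
Qed.

(** The vertex v_(0,m+1) has v_(0,m) as its only parent, so [B] maps the indicator of the former to
    that of the latter. Taking M >= 1 makes its powers monotone. *)
Lemma omega_growth : (exists M : R, forall f, `|B f| <= M%:C * `|f|) ->
  exists2 M : R, 1 <= M & forall a b, (a <= b)%N ->
    normc (omega a) <= M ^+ (b - a) * normc (omega b).
Proof.
move=> [M0 hM0]; pose M := Num.max M0 1.
have M1 : 1 <= M by rewrite le_max lexx orbT.
have step m : normc (omega m) <= M * normc (omega m.+1).
  pose f := levelv m.+1 (fun l => (l == 0)%:R).
  have Bf : B f = levelv m (fun l => (l == 0)%:R).
    apply: ell2_ext => i j; rewrite shiftE /= /level_fun /=.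
    by rewrite addSn addnS eqSS; case: ifP; rewrite ?add0r.
  have : ell2_rnorm (B f) <= M0 * ell2_rnorm f.
    by rewrite -lecR rmorphM; exact: hM0.
  have E k : ell2_rnorm (levelv k (fun l => (l == 0)%:R)) = normc (omega k).
    apply/eqP; rewrite -(@eqrXn2 _ 2)// ?ell2_rnorm_ge0 ?normc_ge0//.
    by rewrite level_unit_sqnorm.
  rewrite Bf !E => /le_trans; apply.
  by rewrite ler_wpM2r ?normc_ge0// le_max lexx.
exists M => // a b; elim: b => [|b IH].
  by rewrite leqn0 => /eqP ->; rewrite subnn mul1r.
rewrite leq_eqVlt => /orP[/eqP ->|ab]; first by rewrite subnn mul1r.
apply: le_trans (IH ab) _; rewrite subSn// exprSr -mulrA ler_wpM2l//.
by rewrite exprn_ge0// (le_trans ler01).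
Qed.

(* The functional with the coefficients of [(1 - x)^q] is nearly annihilated by
   the adjoint of [B^n], so a return to a vector on which it does not vanish
   forces the weight at level [q + n] to be small. *)
Lemma return_weight_small q (eps : R) : 0 < eps -> exists2 d : R, 0 < d &
  forall n (f e : X), (forall v, level (q + n) v -> f v = e v) ->
    ell2_rnorm e < d ->
    ell2_rnorm (levelv q (fun l => 2 * (l == 0)%:R) - iter n B f) < d ->
    w q n < eps.
Proof.
move=> eps0; have [C C0 hC] := @sqcoef_krawt_le R q.
pose S0 := sqcoef (R := R) q.+1 (krawt q 0).
have S00 : 0 <= S0 := sqcoef_ge0 _ _.
have wq0 : 0 < normc (omega q) := normc_gt0 _ (omega0 q).
(* Chosen to give both r^2 S0 <= 1, which bounds the error of the functional by 1, and r^2 C <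
   eps^2, which is the conclusion; the summand 2 makes the latter strict. *)
pose r := Num.min eps 1 / (C + S0 + 2).
have K0 : 0 < C + S0 + 2 by rewrite ltr_wpDl// addr_ge0.
have r0 : 0 < r by rewrite divr_gt0// lt_min eps0 ltr01.
have rK : r * (C + S0 + 2) = Num.min eps 1 by rewrite divfK// gt_eqF.
have re : r * (C + S0 + 2) <= eps by rewrite rK ge_min lexx.
have r1' : r * (C + S0 + 2) <= 1 by rewrite rK ge_min lexx orbT.
have r1 : r ^+ 2 * S0 <= 1 by nra.
have rS0 : 0 <= r * S0 by apply: mulr_ge0; [exact: ltW|].
have rC0 : 0 <= r * C by apply: mulr_ge0; [exact: ltW|].
have r2 : r ^+ 2 * C < eps ^+ 2.
  by rewrite !expr2 -mulrA ltr_pM ?(ltW r0)//; lra.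
exists (normc (omega q) * r); first by rewrite mulr_gt0.
have wr0 : 0 <= normc (omega q) * r by rewrite ltW// mulr_gt0.
move=> n f e fe en gn.
have sk : (size (krawt (R := R) q 0) <= q.+1)%N by rewrite -[X in (_ <= X.+1)%N]addn0 size_krawt.
pose phi (x : X) := \sum_(i < q.+1) ((krawt (R := R) q 0)`_i)%:C * x (i : nat, q - i)%N.
set g := levelv q _ in gn.
(* The value 2 leaves modulus at least 1 for [phi (iter n B f)] once the error is at most 1. *)
have phig : phi g = 2.
  rewrite /phi big_ord_recl /= /level_fun /= subn0 add0n eqxx mulr1.
  rewrite big1 ?addr0; last first.
    by move=> l _; rewrite /= mulr0; case: ifP => _; rewrite mulr0.
  have -> : (krawt (R := R) q 0)`_0 = 1.
    by rewrite -horner_coef0 /krawt expr0 mulr1 horner_exp !hornerE ?subr0 ?expr1n.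
  by rewrite mul1r.
have phiD : phi g = phi (g - iter n B f) + phi (iter n B f).
  have E (c : R[i]) v : c * g v = c * (g - iter n B f) v + c * iter n B f v.
    by rewrite -mulrDr ell2_subE subrK.
  by rewrite /phi -big_split; apply: eq_bigr => i _; exact: E.
have phi1 : normc (phi (g - iter n B f)) <= 1.
  rewrite -ler_sqr ?nnegrE ?normc_ge0// expr1n.
  apply: le_trans (sqcoef_CauchySchwarz _ _ (fun i => (g - iter n B f) (i, q - i)%N)) _.
  rewrite -/S0 -(ler_pM2l (exprn_gt0 2 wq0)) mulrCA mulr1.
  apply: le_trans (ler_wpM2l S00 (level_norm_le _ _)) _.
  apply: (@le_trans _ _ (S0 * (normc (omega q) * r) ^+ 2)).
    by rewrite ler_wpM2l// lerXn2r ?nnegrE ?ell2_rnorm_ge0// ltW.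
  by rewrite exprMn mulrCA -[leRHS]mulr1 ler_wpM2l ?sqr_ge0// mulrC.
have phi2 : 1 <= normc (phi (iter n B f)) ^+ 2.
  rewrite -[leLHS](expr1n _ 2) lerXn2r ?nnegrE ?normc_ge0//.
  have : normc (2 : R[i]) <= normc (phi (g - iter n B f)) + normc (phi (iter n B f)).
    by rewrite -phig phiD -lecR rmorphD; exact: (@ler_normD _ R[i]).
  have -> : normc (2 : R[i]) = 2.
    have -> : (2 : R[i]) = (2 : R)%:C * 1 by rewrite mulr1 rmorph_nat.
    by rewrite normc_realM normc1 mulr1 ger0_norm.
  by move: phi1; lra.
(* Moving B^n to the other side turns (1-x)^q into [krawt q n]; only values on level q+n enter,
   where [f] may be replaced by the small [e]. *)
have phi3 : normc (omega (q + n)%N) ^+ 2 <=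
    sqcoef (q + n).+1 (krawt q n) * (normc (omega q) * r) ^+ 2.
  rewrite -[leLHS]mulr1.
  apply: le_trans (ler_wpM2l (sqr_ge0 _) phi2) _.
  rewrite /phi iter_shift_adjoint//.
  under eq_bigr => l _.
    rewrite fe; last by rewrite /level /= subnKC// -ltnS.
    over.
  have -> : (1 + 'X) ^+ n * krawt q 0 = krawt (R := R) q n.
    by rewrite /krawt expr0 mulr1 mulrC.
  apply: le_trans (ler_wpM2l (sqr_ge0 _)
    (sqcoef_CauchySchwarz _ _ (fun l => e (l, q + n - l)%N))) _.
  rewrite mulrCA ler_wpM2l ?sqcoef_ge0//.
  apply: le_trans (level_norm_le _ _) _.
  by rewrite lerXn2r ?nnegrE ?ell2_rnorm_ge0// ltW.
rewrite -ltr_sqr ?nnegrE ?ltW ?scaled_weight_gt0// sqr_scaled_weight.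
apply: le_lt_trans r2.
rewrite mulrAC ler_pdivrMr ?exprn_gt0// mulrA ler_pdivrMr ?exprn_gt0//.
apply: le_trans (ler_wpM2r _ phi3) _; first by rewrite exprn_ge0.
rewrite mulrAC; apply: le_trans (ler_wpM2r (sqr_ge0 _) (hC n)) _.
by rewrite le_eqVlt; apply/orP; left; apply/eqP; rewrite exprMn; ring.
Qed.

Lemma iter_linearD n (f g : X) : iter n B (f + g) = iter n B f + iter n B g.
Proof. by elim: n => //= n ->; rewrite linearD. Qed.

Lemma iter_linearZ n (c : R[i]) (f : X) : iter n B (c *: f) = c *: iter n B f.
Proof. by elim: n => //= n ->; rewrite linearZ. Qed.

Lemma iter_linear0 n : iter n B (0 : X) = 0.
Proof. by elim: n => //= n ->; rewrite linear0. Qed.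

(** Smallness of one weight at one time n yields small preimages for all times within N of n, as the
    enlarged family demands. The property is stable under linear combinations, so unit vectors
    suffice. *)
Lemma preimage_le (g : X) L N :
  (exists M : R, forall f, `|B f| <= M%:C * `|f|) ->
  (forall v, (L < v.1 + v.2)%N -> g v = 0) ->
  exists2 C : R, 0 <= C & forall n n', (n' <= n + N)%N -> (n <= n' + N)%N ->
    exists2 h : X, iter n' B h = g & ell2_rnorm h <= C * w (L + N) n.
Proof.
move=> bB /ell2_level_decomposition ->; set Q := (L + N)%N.
pose P (g : X) := exists2 C : R, 0 <= C & forall n n', (n' <= n + N)%N ->
  (n <= n' + N)%N -> exists2 h : X, iter n' B h = g & ell2_rnorm h <= C * w Q n.
have P0 : P 0.
  exists 0 => // n n' _ _; exists 0; first exact: iter_linear0.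
  by rewrite -lecR mul0r [X in X <= _](@normr0 _ X).
have PD x y : P x -> P y -> P (x + y).
  move=> [C C0 hC] [D D0 hD]; exists (C + D); first exact: addr_ge0.
  move=> n n' nn nn'; have [h <- hn] := hC n n' nn nn'; have [k <- kn] := hD n n' nn nn'.
  exists (h + k); first exact: iter_linearD.
  by rewrite (le_trans (ell2_rnormD _ _))// mulrDl lerD.
have PZ c x : P x -> P (c *: x).
  move=> [C C0 hC]; exists (normc c * C); first by rewrite mulr_ge0// normc_ge0.
  move=> n n' nn nn'; have [h <- hn] := hC n n' nn nn'.
  exists (c *: h); first exact: iter_linearZ.
  by rewrite (le_trans (ell2_rnormZ_le _ _))// -mulrA ler_wpM2l// normc_ge0.
have [M M1 hM] := omega_growth bB.
apply: (big_ind P P0 PD) => q _; apply: (big_ind P P0 PD) => i _; apply: PZ.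
have iq : (i <= q)%N by rewrite -ltnS.
have qL : (q <= L)%N by rewrite -ltnS.
have [C C0 hC] := shift_right_inverse _ _ iq.
pose sN : R := Num.sqrt N.+1%:R ^+ (2 * Q).+1.
have M0 : 0 <= M by rewrite (le_trans ler01).
(* Cost of replacing q, n' by Q, n: 4^N for the power of 4; M^(Q+N) for the weights, as q+n' <= Q+n;
   [sN] for the roots, as n'+1 <= (N+1)(n+1); and |omega_Q|^2 cancels the denominator of [w Q n]. *)
pose K := 4 ^+ N * C * (M ^+ (Q + N)) ^+ 2 * normc (omega Q) ^+ 2 * sN.
have K0 : 0 <= K by rewrite !mulr_ge0 ?exprn_ge0 ?normc_ge0 ?sqrtr_ge0.
exists (Num.sqrt K); first exact: sqrtr_ge0.
move=> n n' nn nn'; have [h hh hn] := hC n'; exists h => //.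
have w0 := scaled_weight_gt0 omega Q n omega0.
have Kw0 : 0 <= Num.sqrt K * w Q n by apply: mulr_ge0; [exact: sqrtr_ge0 | exact: ltW].
rewrite -ler_sqr ?nnegrE ?ell2_rnorm_ge0//.
rewrite exprMn (sqr_sqrtr K0) sqr_scaled_weight.
have wQ0 : 0 < normc (omega Q) ^+ 2 by rewrite exprn_gt0// normc_gt0.
set s := Num.sqrt n.+1%:R.
have -> : K * (normc (omega (Q + n)%N) ^+ 2 / normc (omega Q) ^+ 2 *
    (s ^+ (2 * Q).+1 / 4 ^+ n)) =
    4 ^+ N * (C * (M ^+ (Q + N) * normc (omega (Q + n)%N)) ^+ 2 *
      (sN * s ^+ (2 * Q).+1)) / 4 ^+ n.
  by rewrite /K; field; rewrite expf_neq0 ?gt_eqF// normc_gt0.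
rewrite ler_pdivlMr ?exprn_gt0//.
apply: (@le_trans _ _ (4 ^+ N * (ell2_rnorm h ^+ 2 * 4 ^+ n'))).
  rewrite mulrCA ler_wpM2l ?sqr_ge0// -exprD ler_eXn2l; last by rewrite ltr1n.
  by rewrite addnC.
rewrite ler_wpM2l ?exprn_ge0//; apply: le_trans hn _.
apply: ler_pM.
- by rewrite mulr_ge0 ?sqr_ge0.
- by rewrite exprn_ge0 ?sqrtr_ge0.
- rewrite ler_wpM2l// lerXn2r ?nnegrE ?normc_ge0 ?mulr_ge0 ?exprn_ge0//.
    exact: normc_ge0.
  apply: le_trans (hM _ (Q + n)%N _) _; first by rewrite /Q; lia.
  rewrite ler_wpM2r ?normc_ge0// ler_weXn2l//; rewrite /Q; lia.
- rewrite /sN -exprMn -sqrtrM//.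
  apply: (@le_trans _ _ (Num.sqrt n'.+1%:R ^+ (2 * Q).+1)).
    rewrite ler_weXn2l//; last by rewrite /Q; lia.
    by rewrite -[X in X <= _]sqrtr1 ler_wsqrtr// ler1n.
  rewrite lerXn2r ?nnegrE ?sqrtr_ge0// ler_wsqrtr// -natrM ler_nat.
  by rewrite mulSn mulnS; lia.
Qed.

End Shift.

Lemma shift_bounds {n n' N : nat} {k : int} : - N%:Z <= k -> k <= N%:Z ->
  n'%:Z = n%:Z + k -> (n' <= n + N)%N /\ (n <= n' + N)%N.
Proof. by lia. Qed.

(** * Return sets and the weight condition *)

Section Transitivity.
Context {R : realType} {omega : nat -> R[i]} {omega0 : forall n, omega n != 0}.
Local Notation X := (ell2 (level_weight_neq0 omega0)).
Local Notation levelv := (level_vec (omega0 := omega0)).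
Context {B : {linear X -> X}}.
Hypothesis B_shift : forall f, B f = lattice_shift f :> (nat * nat -> R[i]).
Context {F : set (set nat)}.
Hypothesis F_up : forall A C : set nat, F A -> A `<=` C -> F C.
Local Notation w := (scaled_weight omega).

(** Orbits going from a ball about 0 to a ball about [g] start at a small [f], which itself serves
    as the small vector [e]. *)
Lemma transitive_weight : family_transitive F B -> forall q eps, 0 < eps ->
  F [set n : nat | (0 < n)%N /\ w q n < eps].
Proof.
move=> tB q eps eps0.
(* The cap at 1 excludes n = 0, where the weight quantity equals 1. *)
have [d d0 hd] : exists2 d : R, 0 < d & _ :=
  return_weight_small B_shift q (Num.min eps 1) ltac:(by rewrite lt_min eps0 ltr01).
pose g := levelv q (fun l => 2 * (l == 0)%:R).
apply: F_up (tB (ball (0 : X) d%:C) (ball g d%:C) _ _ _ _) _.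
- exact: ball_open.
- by exists 0; exact: ell2_ball_center.
- exact: ball_open.
- by exists g; exact: ell2_ball_center.
move=> n [_ [[f f0 <-] gf]]; rewrite !ell2_ballE in f0 gf.
have := hd n f f (fun _ _ => erefl) _ gf.
rewrite lt_min => /(_ _)/andP[|wn w1].
  move: f0; rewrite -!ltcR [X in X < _ -> _](_ : _ = `|0 - f|)//.
  by rewrite sub0r normrN.
split=> //; rewrite lt0n; apply/eqP => n0; move: w1.
by rewrite n0 scaled_weight0// ltxx.
Qed.

(** For a return to a ball about [g], the small vector is f - g: since [g] lives on level q, it
    agrees with [f] on level q+n as soon as n >= 1, and the tail property discards n = 0. *)
Lemma recurrent_weight :
  (forall (A : set nat) (N : nat), (0 < N)%N -> F A ->
     F (A `&` [set n | (N <= n)%N])) ->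
  family_recurrent F B -> forall q eps, 0 < eps ->
  F [set n : nat | (0 < n)%N /\ w q n < eps].
Proof.
move=> F_tail rB q eps eps0.
have [d d0 hd] := return_weight_small B_shift q eps eps0.
pose g := levelv q (fun l => 2 * (l == 0)%:R).
have FU : F (return_set B (ball g d%:C) (ball g d%:C)).
  by apply: rB; [exact: ball_open | exists g; exact: ell2_ball_center].
apply: F_up (F_tail _ 1 _ FU) _ => //.
move=> n [[_ [[f fg <-] gf]] /= n1]; rewrite !ell2_ballE in fg gf.
split=> //; apply: (hd n f (f - g)) => // [[i j] ij|].
  rewrite ell2_subE [g _]/= /level_fun ifN ?subr0// /= [(i + j)%N]ij.
  by rewrite -[X in _ != X]addn0 eqn_add2l -lt0n.
move: fg; rewrite -!ltcR [X in X < _ -> _](_ : _ = `|g - f|)//.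
by rewrite distrC.
Qed.

(** The connecting vector is f + h, with [f] in U and [g] in V finitely supported and [h] a small
    preimage of [g]; [f] is annihilated in the meantime. *)
Lemma weight_transitive_enlarged :
  (exists M : R, forall f, `|B f| <= M%:C * `|f|) ->
  (forall q eps, 0 < eps -> F [set n : nat | (0 < n)%N /\ w q n < eps]) ->
  family_transitive (enlarged_family F) B.
Proof.
move=> bB wF U V oU [f0 Uf0] oV [g0 Vg0] N.
have [e1 e10 he1] := ell2_ball_open _ _ oU Uf0.
have [e2 e20 he2] := ell2_ball_open _ _ oV Vg0.
have [f [L1 [fL1 ff]]] := ell2_finite_approx f0 _ (divr_gt0 e10 (ltr0n R 2)).
have [g [L2 [gL2 /he2 Vg]]] := ell2_finite_approx g0 _ e20.
pose L := maxn L1 L2; pose Q := (L + N)%N.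
have fL v : (L < v.1 + v.2)%N -> f v = 0.
  by move=> Lv; apply: fL1; apply: leq_ltn_trans Lv; exact: leq_maxl.
have gL v : (L < v.1 + v.2)%N -> g v = 0.
  by move=> Lv; apply: gL2; apply: leq_ltn_trans Lv; exact: leq_maxr.
have [C C0 hC] := preimage_le B_shift g L N bB gL.
have [d d0 hd] := @pos_lower_bound R (w Q) Q (fun n => scaled_weight_gt0 omega Q n omega0).
(* The bound [d] forces n > Q = L+N, hence n' > L, so that B^n' kills [f]; the other bound keeps [h]
   below e1/2. *)
pose eps := Num.min d (e1 / 2 / (C + 1)).
have C1 : 0 < C + 1 by rewrite ltr_wpDl.
have eps0 : 0 < eps by rewrite lt_min d0 !divr_gt0.
exists [set n : nat | (0 < n)%N /\ w Q n < eps]; first exact: wF.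
move=> n' [n [k [[_ wn] /andP[k1 k2] n'E]]].
have [wd we] : w Q n < d /\ w Q n < e1 / 2 / (C + 1).
  by move: wn; rewrite lt_min => /andP.
have nQ : (Q < n)%N.
  by rewrite ltnNge; apply/negP => nQ; have := hd n nQ; rewrite leNgt wd.
have [nn nn'] := shift_bounds k1 k2 n'E.
have [h hg hn] := hC n n' nn nn'.
exists g; split=> //; exists (f + h).
  apply: he1; apply: (@le_lt_trans _ _ (ell2_rnorm (f0 - f) + ell2_rnorm h)).
    rewrite -lecR rmorphD opprD addrA.
    exact: (ler_normB (f0 - f) h).
  rewrite [ltRHS](splitr e1) ltrD//; apply: le_lt_trans hn _.
  apply: (@le_lt_trans _ _ ((C + 1) * w Q n)).
    by rewrite ler_wpM2r ?lerDl// ltW// scaled_weight_gt0.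
  by rewrite mulrC -ltr_pdivlMr.
rewrite iter_linearD hg (iter_shift_vanish B_shift) ?add0r// => v nv.
by apply: fL; apply: leq_trans nv; rewrite -(ltn_add2r N); exact: leq_trans nQ nn'.
Qed.

End Transitivity.

Theorem theorem4p6 (R : realType) (omega : nat -> R[i])
    (omega0 : forall n, omega n != 0)
    (B : {linear ell2 (level_weight_neq0 omega0) ->
                 ell2 (level_weight_neq0 omega0)})
    (B_shift : forall f, B f = lattice_shift f :> (nat * nat -> R[i]))
    (B_bounded : exists M : R, forall f, `|B f| <= M%:C * `|f|)
    (F : set (set nat)) (F_furstenberg : furstenberg_family F) :
  let transitive_enlarged := family_transitive (enlarged_family F) B in
  let transitive := family_transitive F B in
  let weight_condition := forall (q : nat) (eps : R), 0 < eps ->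
    F [set n : nat | (0 < n)%N /\
         normc (omega (q + n)%N) / normc (omega q) *
         ((n.+1%:R `^ (q%:R / 2 + 1 / 4)) / 2 ^+ n) < eps] in
  let recurrent := family_recurrent F B in
  [/\ transitive_enlarged <-> transitive,
      transitive <-> weight_condition
    & (forall (A : set nat) (N : nat), (0 < N)%N -> F A ->
         F (A `&` [set n | (N <= n)%N])) ->
      recurrent <-> transitive].
Proof.
move=> te t wc rc.
have [_ _ F_up] := F_furstenberg.
have te_t : te -> t.
  (* With N = 0 the enlarged condition only says that the return set contains a member of F. *)
  move=> h U V oU U0 oV V0; have [D FD DU] := h U V oU U0 oV V0 0.
  apply: F_up FD _ => n Dn; apply: DU; exists n, 0.
  by split=> //; rewrite addr0.
have t_wc : t -> wc := transitive_weight B_shift F_up.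
have wc_te : wc -> te := weight_transitive_enlarged B_shift B_bounded.
split.
- by split=> [|/t_wc].
- by split=> // /wc_te.
- move=> F_tail; split=> [/(recurrent_weight B_shift F_up F_tail)/wc_te//|h U oU U0].
  exact: h.
Qed.
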